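(* Let $0<\alpha<\pi$. For every set $E$ of $n$ points in $\mathbb{R}^2$, the number of pairs $(x_2,x_3)\in E^2$ with $\angle(0,x_2,x_3)=\alpha$ (where $0$ is the origin) is $\lesssim n^{4/3}$. Moreover this is sharp: for every large $n$ there is a set of $\approx n$ points in $\mathbb{R}^2$ for which the number of such pairs is $\gtrsim n^{4/3}$.
   Context: $\angle(x,y,z)\in[0,\pi]$ denotes the angle at $y$ between $x-y$ and $z-y$ (for $x\ne y\ne z$). $X(n)\lesssim Y(n)$ means $X(n)\le CY(n)$ for all $n>N$ with constants $C,N$ independent of $n$ (possibly depending on $\alpha$); $\gtrsim$ is the reverse relation and $\approx$ means both hold. *)

(* Defs.v *)
From mathcomp Require Import all_boot all_order all_algebra finmap.
From mathcomp Require Import reals exp trigo.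

Set Implicit Arguments.
Unset Strict Implicit.
Unset Printing Implicit Defensive.

Import Order.TTheory GRing.Theory Num.Theory.
Local Open Scope ring_scope.
Local Open Scope fset_scope.

Definition dot (R : realType) (u v : 'rV[R]_2) : R :=
  \sum_(i < 2) u 0 i * v 0 i.

(* The norm that MathComp-Analysis puts on 'rV[R]_2 is the sup norm, hence
   this definition of the Euclidean one. *)
Definition enorm (R : realType) (u : 'rV[R]_2) : R := Num.sqrt (dot u u).

(* Meaningful only if x != y and y != z; otherwise the division by zero makes
   the value acos 0 = pi / 2. *)
Definition angle (R : realType) (x y z : 'rV[R]_2) : R :=
  acos (dot (x - y) (z - y) / (enorm (x - y) * enorm (z - y))).

(* The pairs (x2, x3) for which the angle at x2 between 0 and x3 is defined
   and equals alpha. *)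
Definition angle_pairs (R : realType) (alpha : R) (E : {fset 'rV[R]_2}) :
    {fset 'rV[R]_2 * 'rV[R]_2} :=
  [fset p in E `*` E |
    [&& 0 != p.1, p.1 != p.2 & angle 0 p.1 p.2 == alpha]].

(* Main.v *)
(** The angle condition puts [x3] on one of two lines attached to [x2], and for
    each of the two choices the line determines [x2]. The upper bound is thus the
    Szemeredi-Trotter bound for [n] points and [n] lines. As in Szekely's proof,
    join consecutive points on each line; this gives a graph whose edges cross at
    most once per pair of lines. A graph on [v] vertices drawn with [e] straight
    edges has at least [e - 3 v] crossings, because in a noncrossing one every
    edge is the topmost edge leaving its left end, or the topmost edge entering
    its right end, or the edge directly below some vertex. Keeping each vertex
    with probability [1/q] amplifies this to [e <= 3 v q + (number of crossings)
    / q^2], and [q] is taken of order [n^(1/3)].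

    For the sharpness take the [k * 2k^2] grid with the [k^3] lines that each meet
    it [k] times, sheared so that every line has slope at least [- cot alpha]. On
    such a line the apex [x2] of the angle lies to the left of the whole grid. *)
Require Import Defs.
From mathcomp Require Import all_boot all_order all_algebra finmap.
From mathcomp Require Import boolp reals exp trigo.
From mathcomp Require Import zify ring lra.

Set Implicit Arguments.
Unset Strict Implicit.
Unset Printing Implicit Defensive.

Import Order.TTheory GRing.Theory Num.Theory.
Local Open Scope ring_scope.

(** Charging argument: choose a related element of [B] for each element of [A]; no two can share
    one. *)
Lemma leq_card_rel (T U : finType) (A : {set T}) (B : {set U})
    (rel : T -> U -> Prop) :
  (forall a, a \in A -> exists2 c, c \in B & rel a c) ->
  (forall a a' c, a \in A -> a' \in A -> rel a c -> rel a' c -> a = a') ->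
  (#|A| <= #|B|)%N.
Proof.
move=> total inj; have [->|[a0 Aa0]] := set_0Vmem A; first by rewrite cards0.
have [c0 _ _] := total _ Aa0.
have /choice [f fP] : forall a, exists c, a \in A -> c \in B /\ rel a c.
  by move=> a; case: (boolP (a \in A)) => [/total[c]|_]; [exists c | exists c0].
rewrite -(card_in_imset (f := f)).
  by apply/subset_leq_card/subsetP => _ /imsetP[a /fP[fB _] ->].
by move=> a a' Aa Aa' eqf; apply: (inj a a' (f a)) => //; rewrite ?eqf;
  [case: (fP a Aa) | case: (fP a' Aa')] => //; rewrite eqf.
Qed.

(** * Noncrossing straight-line graphs *)

Section PlaneSegments.
Variables (R : realFieldType) (V G : finType) (x y : V -> R).
Variables (src tgt : G -> V) (slope icpt : G -> R).

Definition height g X := slope g * X + icpt g.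
Definition within g X := x (src g) < X < x (tgt g).
(** Ends are excluded, so edges that meet only at a common end do not cross, while distinct edges
    overlapping on one line do. *)
Definition cross g h :=
  `[< g <> h /\ exists X, [/\ within g X, within h X & height g X = height h X] >].

Hypothesis x_inj : injective x.
Hypothesis src_tgt : forall g, x (src g) < x (tgt g).
Hypothesis y_src : forall g, y (src g) = height g (x (src g)).
Hypothesis y_tgt : forall g, y (tgt g) = height g (x (tgt g)).
Hypothesis segment_empty :
  forall g w, within g (x w) -> y w <> height g (x w).

(** The difference of the heights is affine, so its zero is explicit and any ordered field will
    do. *)
Lemma height_ivt g h X1 X2 : X1 < X2 ->
  height g X1 < height h X1 -> height h X2 < height g X2 ->
  exists X, X1 < X < X2 /\ height g X = height h X.
Proof.
rewrite /height => X12 gh1 hg2.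
have d_gt0 : 0 < slope g - slope h.
  rewrite ltNge; apply/negP => sgh.
  have : (slope g - slope h) * (X2 - X1) <= 0 by nra.
  by nra.
have defX : (slope g - slope h) * ((icpt h - icpt g) / (slope g - slope h)) =
    icpt h - icpt g by field; rewrite gt_eqF.
exists ((icpt h - icpt g) / (slope g - slope h)).
set X := _ / _ in defX *; clearbody X; split; last by lra.
by apply/andP; split; rewrite ltNge; apply/negP => ?; nra.
Qed.

Section Noncrossing.
Variables (A : {set G}) (S : {set V}).
Hypothesis src_in : {in A, forall g, src g \in S}.
Hypothesis tgt_in : {in A, forall g, tgt g \in S}.
Hypothesis noncrossing : {in A &, forall g h, ~~ cross g h}.

Lemma noncrossing_inj g h X : g \in A -> h \in A -> within g X -> within h X ->
  height g X = height h X -> g = h.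
Proof.
move=> Ag Ah gX hX eqX; apply: contrapT => neq_gh.
by move: (noncrossing Ag Ah) => /asboolPn; apply; split=> //; exists X.
Qed.

(** A change of order would force a crossing strictly between [X] and [X']. Strictness may be lost
    at a common end. *)
Lemma noncrossing_le g h X X' : g \in A -> h \in A ->
  x (src g) <= X <= x (tgt g) -> x (src h) <= X <= x (tgt h) ->
  x (src g) <= X' <= x (tgt g) -> x (src h) <= X' <= x (tgt h) ->
  height g X < height h X -> height g X' <= height h X'.
Proof.
move=> Ag Ah /andP[gX Xg] /andP[hX Xh] /andP[gX' X'g] /andP[hX' X'h] ltX.
rewrite leNgt; apply/negP => ltX'.
have [X0 [gX0 hX0 eqX0]] :
    exists X0, [/\ within g X0, within h X0 & height g X0 = height h X0].
  rewrite /within; case: (ltgtP X X') => [XX'|X'X|eqXX'].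
  - by have [X0 [/andP[? ?] ?]] := height_ivt XX' ltX ltX'; exists X0; split => //; lra.
  - by have [X0 [/andP[? ?] ?]] := height_ivt X'X ltX' ltX; exists X0; split => //; lra.
  - by move: ltX; rewrite eqXX' => /(lt_trans ltX'); rewrite ltxx.
by have eq_gh := noncrossing_inj Ag Ah gX0 hX0 eqX0; move: ltX; rewrite eq_gh ltxx.
Qed.

Definition top_right g := forall h, h \in A -> src h = src g -> slope h <= slope g.
(** To the left of a common right end, the edge of smaller slope is the higher one. *)
Definition top_left g := forall h, h \in A -> tgt h = tgt g -> slope g <= slope h.
Definition below g w := [/\ within g (x w), height g (x w) < y w &
  forall h, h \in A -> within h (x w) -> height h (x w) < y w ->
    height h (x w) <= height g (x w)].

(** Two such edges have the same left end and slope, so they overlap just to the right of that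
    end. *)
Lemma top_right_inj g h : g \in A -> h \in A -> src g = src h ->
  top_right g -> top_right h -> g = h.
Proof.
move=> Ag Ah eq_l /(_ _ Ah (esym eq_l)) hg /(_ _ Ag eq_l) gh.
have eqs : slope g = slope h by apply/le_anti; rewrite hg gh.
have [lg lh] := (src_tgt g, src_tgt h).
have [ylg ylh] := (y_src g, y_src h).
have [X /andP[lX /andP[Xg Xh]]] :
    exists X, [&& x (src g) < X, X < x (tgt g) & X < x (tgt h)].
  rewrite -eq_l in lh.
  case: (leP (x (tgt g)) (x (tgt h))) => ?.
    by exists ((x (src g) + x (tgt g)) / 2); apply/and3P; split; lra.
  by exists ((x (src g) + x (tgt h)) / 2); apply/and3P; split; lra.
apply: (noncrossing_inj (X := X)) => //; rewrite /within ?lX -?eq_l ?lX //.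
by move: ylg ylh; rewrite /height -eq_l -eqs => -> /addrI ->.
Qed.

Lemma top_left_inj g h : g \in A -> h \in A -> tgt g = tgt h ->
  top_left g -> top_left h -> g = h.
Proof.
move=> Ag Ah eq_l /(_ _ Ah (esym eq_l)) hg /(_ _ Ag eq_l) gh.
have eqs : slope g = slope h by apply/le_anti; rewrite hg gh.
have [lg lh] := (src_tgt g, src_tgt h).
have [ylg ylh] := (y_tgt g, y_tgt h).
have [X /andP[lX /andP[Xg Xh]]] :
    exists X, [&& X < x (tgt g), x (src g) < X & x (src h) < X].
  rewrite -eq_l in lh.
  case: (leP (x (src g)) (x (src h))) => ?.
    by exists ((x (src h) + x (tgt g)) / 2); apply/and3P; split; lra.
  by exists ((x (src g) + x (tgt g)) / 2); apply/and3P; split; lra.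
apply: (noncrossing_inj (X := X)) => //; rewrite /within ?Xg ?Xh -?eq_l ?lX //.
by move: ylg ylh; rewrite /height -eq_l -eqs => -> /addrI ->.
Qed.

Lemma below_inj g h w : g \in A -> h \in A -> below g w -> below h w -> g = h.
Proof.
move=> Ag Ah [gw ltg gP] [hw lth hP]; apply: (noncrossing_inj Ag Ah gw hw).
by apply/le_anti; rewrite hP ?gP.
Qed.

(* If [e] is not the topmost edge leaving its left end, let [e'] be the next one
   above it; [w] is the first vertex met when sweeping the wedge between [e] and
   [e'] to the right, hence no edge enters the wedge before [w]. *)
Lemma top_or_below e : e \in A ->
  top_right e \/ top_left e \/ exists2 w, w \in S & below e w.
Proof.
move=> Ae; have [|] := pselect (top_right e); first by left.
move=> /existsNP[g0 /not_implyP[Ag0 /not_implyP[lg0 /negP]]].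
rewrite -ltNge => sg0; right.
pose P g := [&& g \in A, src g == src e & slope e < slope g].
have Pg0 : P g0 by rewrite /P Ag0 lg0 eqxx.
case: (arg_minP slope Pg0) => e' /and3P[Ae' /eqP le' se'] e'min.
(* The vertices in the closed wedge, apex excluded, up to the nearer right end, which is itself one
   of them. *)
pose Q w := [&& w \in S, x (src e) < x w, x w <= x (tgt e), x w <= x (tgt e'),
  height e (x w) <= y w & y w <= height e' (x w)].
have [lre lre'] := (src_tgt e, src_tgt e').
have [yle yle'] := (y_src e, y_src e').
have [yre yre'] := (y_tgt e, y_tgt e').
rewrite le' in lre' yle'.
have [w0 Qw0] : exists w, Q w.
  case: (leP (x (tgt e)) (x (tgt e'))) => xr; [exists (tgt e)|exists (tgt e')].
    by rewrite /Q tgt_in // lre xr lexx yre lexx /=; rewrite /height in yle yle' *; nra.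
  rewrite /Q tgt_in // lre' (ltW xr) lexx yre' lexx andbT /=.
    by rewrite /height in yle yle' *; nra.
case: (arg_minP x Qw0) => w /andP[Sw /and5P[w1 w2 w3 w4 w5]] wmin.
(* The left end of such a [g] would be a vertex of the wedge before [w]; or lie left of the apex,
   forcing [g] through the vertex [src e]; or be the apex, so that [g] contradicts the choice of
   [e']. *)
have wedge_empty g X : g \in A -> x (src e) < X -> X <= x w -> x (src g) < X ->
    X <= x (tgt g) -> height e X < height g X -> height g X < height e' X -> False.
  move=> Ag eX Xw gX Xg hteg htge'.
  have ylg := y_src g.
  have Xe := le_trans Xw w2; have Xe' := le_trans Xw w3.
  case: (ltgtP (x (src e)) (x (src g))) => [lelg|lgle|/x_inj eqlg].
  - suff /wmin : Q (src g) by rewrite leNgt (lt_le_trans gX Xw).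
    have ? := src_tgt g.
    rewrite /Q src_in // lelg ylg /=; apply/and4P; split; try lra.
      by apply: (noncrossing_le (X := X)) => //; rewrite ?le'; lra.
    by apply: (noncrossing_le (X := X)) => //; rewrite ?le'; lra.
  - have gle : within g (x (src e)) by rewrite /within lgle /=; lra.
    have h1 : height e (x (src e)) <= height g (x (src e)).
      by apply: (noncrossing_le (X := X)) => //; rewrite /within in gle *; lra.
    have h2 : height g (x (src e)) <= height e' (x (src e)).
      by apply: (noncrossing_le (X := X)) => //; rewrite ?le' /within in gle *; lra.
    by apply: (segment_empty gle); lra.
  - have : slope e' <= slope g.
      apply: e'min; rewrite /P Ag eqlg eqxx /=.
      by rewrite /height -eqlg in hteg yle ylg *; nra.
    by rewrite /height -eqlg in htge' yle' ylg *; nra.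
have [eqw|neqw] := eqVneq w (tgt e); [left|right; exists w => //].
(* An edge entering [tgt e] with smaller slope lies above [e] at [X] and, not crossing [e'], below
   [e']: it would be in the empty wedge. *)
- move=> g Ag rg; rewrite leNgt; apply/negP => sg.
  have [lrg yrg] := (src_tgt g, y_tgt g).
  rewrite eqw {eqw w1 w2 w4} in w3 w5 wmin wedge_empty.
  rewrite rg in lrg yrg.
  have [X /and3P[eX gX Xe]] :
      exists X, [&& x (src e) < X, x (src g) < X & X < x (tgt e)].
    case: (leP (x (src g)) (x (src e))) => ?.
      by exists ((x (src e) + x (tgt e)) / 2); apply/and3P; split; lra.
    by exists ((x (src g) + x (tgt e)) / 2); apply/and3P; split; lra.
  have ltr : height g (x (tgt e)) < height e' (x (tgt e)).
    by rewrite -yrg yre; rewrite /height in yle yle' *; nra.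
  have leX : height g X <= height e' X.
    by apply: (noncrossing_le (X := x (tgt e))) => //; rewrite ?rg ?le'; lra.
  apply: (wedge_empty g X) => //; rewrite ?rg; [lra|lra| |].
    by rewrite /height in yre yrg *; nra.
  rewrite lt_neqAle leX andbT; apply/eqP => eqX.
  have eq_ge' : g = e'.
    by apply: (noncrossing_inj (X := X)) => //; rewrite /within ?rg ?le'; lra.
  by move: ltr; rewrite eq_ge' ltxx.
(* An edge passing between [e] and [w] would also lie in the empty wedge, so [e] is directly below
   [w]. *)
- have we : within e (x w).
    rewrite /within w1 lt_neqAle w2 andbT.
    by apply: contra neqw => /eqP /x_inj ->.
  split=> //.
    by rewrite lt_neqAle w4 andbT eq_sym; apply/eqP/segment_empty.
  move=> h Ah /andP[hw wh] hty; rewrite leNgt; apply/negP => hte.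
  by apply: (wedge_empty h (x w)) => //; lra.
Qed.

(** The three alternatives of [top_or_below] charge an edge to its left end, its right end or the
    vertex above it, each injectively. *)
Lemma noncrossing_card : (#|A| <= 3 * #|S|)%N.
Proof.
pose A1 := [set e in A | `[< top_right e >]].
pose A2 := [set e in A | `[< top_left e >]].
pose A3 := [set e in A | `[< exists2 w, w \in S & below e w >]].
have subA : A \subset A1 :|: A2 :|: A3.
  apply/subsetP => e Ae; rewrite !inE Ae /=.
  by case: (top_or_below Ae) => [|[|]] /asboolP ->; rewrite ?orbT.
have c1 : (#|A1| <= #|S|)%N.
  apply: (leq_card_rel (rel := fun e w => src e = w)) => [e|e f w].
    by rewrite inE => /andP[Ae _]; exists (src e) => //; exact: src_in.
  rewrite !inE => /andP[Ae /asboolP te] /andP[Af /asboolP tf] <- /esym eq_l.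
  exact: top_right_inj.
have c2 : (#|A2| <= #|S|)%N.
  apply: (leq_card_rel (rel := fun e w => tgt e = w)) => [e|e f w].
    by rewrite inE => /andP[Ae _]; exists (tgt e) => //; exact: tgt_in.
  rewrite !inE => /andP[Ae /asboolP te] /andP[Af /asboolP tf] <- /esym eq_l.
  exact: top_left_inj.
have c3 : (#|A3| <= #|S|)%N.
  apply: (leq_card_rel (rel := below)) => [e|e f w].
    by rewrite inE => /andP[Ae /asboolP].
  by rewrite !inE => /andP[Ae _] /andP[Af _]; exact: below_inj.
have := subset_leq_card subA; have [c4 _] := leq_card_setU (A1 :|: A2) A3.
by have [c5 _] := leq_card_setU A1 A2; lia.
Qed.

End Noncrossing.

(** Deleting one edge of a crossing pair loses one edge and at least one ordered crossing pair;
    iterate until [noncrossing_card] applies. *)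
Lemma card_le_crossings (A : {set G}) (S : {set V}) :
  {in A, forall g, src g \in S} -> {in A, forall g, tgt g \in S} ->
  (#|A| <= 3 * #|S| + #|[set p in setX A A | cross p.1 p.2]|)%N.
Proof.
have [n] := ubnP #|A|; elim: n A => // n IH A ltAn srcA tgtA.
have [nc|[g [h [Ag Ah gh]]]] : {in A &, forall g h, ~~ cross g h} \/
    exists g h, [/\ g \in A, h \in A & cross g h].
- have [?|nex] := pselect (exists g h, [/\ g \in A, h \in A & cross g h]).
    by right.
  by left=> g h Ag Ah; apply/negP => gh; apply: nex; exists g, h.
- by apply: leq_trans (leq_addr _ _); apply: noncrossing_card.
have cA := cardsD1 g A; rewrite Ag in cA.
have sub : A :\ g \subset A by apply: subsetDl.
have /IH H : (#|A :\ g| < n)%N by lia.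
have {H} := H (fun a Aa => srcA a (subsetP sub a Aa)) (fun a Aa => tgtA a (subsetP sub a Aa)).
have : (#|[set p in setX (A :\ g) (A :\ g) | cross p.1 p.2]| <
    #|[set p in setX A A | cross p.1 p.2]|)%N.
  apply: proper_card; apply/properP; split.
    by apply/subsetP => p; rewrite !inE => /andP[/andP[/andP[_ ->] /andP[_ ->]] ->].
  by exists (g, h); rewrite !inE /= ?Ag ?Ah //= eqxx.
by lia.
Qed.

End PlaneSegments.

(** * The crossing inequality by random sampling *)

Lemma sum_card_exchange (T U : finType) (P : T -> U -> bool) :
  (\sum_t #|[set u | P t u]| = \sum_u #|[set t | P t u]|)%N.
Proof.
under eq_bigr do rewrite -sum1_card big_mkcond.
rewrite exchange_big; apply: eq_bigr => u _.
rewrite -sum1_card [RHS]big_mkcond; apply: eq_bigr => t _.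
by rewrite !inE.
Qed.

(** A random colouring is [ord0] on all of [D] with probability [1 / q.+1 ^ #|D|]; clearing the
    denominator keeps this in [nat]. *)
Lemma card_ffun_vanishing (V : finType) q (D : {set V}) :
  (#|[set f : {ffun V -> 'I_q.+1} | [forall v in D, f v == ord0]]| * q.+1 ^ #|D|
    = q.+1 ^ #|V|)%N.
Proof.
pose F v : pred 'I_q.+1 := if v \in D then pred1 ord0 else predT.
have -> : #|[set f : {ffun V -> 'I_q.+1} | [forall v in D, f v == ord0]]| =
    #|family F|.
  apply: eq_card => f; rewrite inE; apply/forallP/familyP => fP v; move: (fP v);
    by rewrite /F; case: (v \in D).
rewrite card_family foldrE big_map big_enum -prod_nat_const.
rewrite [X in (_ * X)%N]big_mkcond -big_split -[RHS]prod_nat_const /=.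
apply: eq_bigr => v _; rewrite /F; case: (v \in D); first by rewrite card1 mul1n.
by rewrite muln1 card_ord.
Qed.

(* Keep each vertex with probability [1/q], i.e. when a uniformly random map
   from the vertices to [q] colours gives it colour [0]. *)
Lemma sampling_crossings (R : realFieldType) (V G : finType) (x y : V -> R)
    (src tgt : G -> V) (slope icpt : G -> R) (q : nat) :
  injective x -> (forall g, x (src g) < x (tgt g)) ->
  (forall g, y (src g) = height slope icpt g (x (src g))) ->
  (forall g, y (tgt g) = height slope icpt g (x (tgt g))) ->
  (forall g w, within x src tgt g (x w) -> y w <> height slope icpt g (x w)) ->
  (forall g h, cross x src tgt slope icpt g h ->
     uniq [:: src g; tgt g; src h; tgt h]) ->
  (#|G| * q ^ 2 <= 3 * #|V| * q ^ 3 +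
    #|[set p : G * G | cross x src tgt slope icpt p.1 p.2]|)%N.
Proof.
move=> x_inj src_tgt y_src y_tgt empty disj.
case: q => [|q]; first by rewrite muln0.
pose colouring := {ffun V -> 'I_q.+1}.
pose S (f : colouring) := [set v | f v == ord0].
pose A (f : colouring) := [set g | (f (src g) == ord0) && (f (tgt g) == ord0)].
pose X (f : colouring) :=
  [set p in setX (A f) (A f) | cross x src tgt slope icpt p.1 p.2].
(* The inequality for each sample, summed over all colourings; [eS], [eA] and [eX] evaluate the
   three sums. *)
have key : (\sum_f #|A f| <= 3 * (\sum_f #|S f|) + \sum_f #|X f|)%N.
  rewrite big_distrr -big_split /=; apply: leq_sum => f _.
  by apply: card_le_crossings => // g; rewrite !inE => /andP[].
have cV : (#|{: colouring}| = q.+1 ^ #|V|)%N.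
  by rewrite card_ffun card_ord.
have eS : ((\sum_f #|S f|) * q.+1 = #|V| * q.+1 ^ #|V|)%N.
  rewrite (sum_card_exchange (fun (f : colouring) v => f v == ord0) : \sum_f #|S f| = _)%N.
  rewrite big_distrl /= -sum_nat_const; apply: eq_bigr => v _.
  rewrite -(card_ffun_vanishing q [set v]) cards1 expn1; congr (_ * _)%N.
  apply: eq_card => f; rewrite !inE.
  apply/idP/forallP => [fv w|/(_ v)]; last by rewrite inE eqxx.
  by rewrite inE; apply/implyP => /eqP->.
have eA : ((\sum_f #|A f|) * q.+1 ^ 2 = #|G| * q.+1 ^ #|V|)%N.
  rewrite (sum_card_exchange (fun (f : colouring) g =>
    (f (src g) == ord0) && (f (tgt g) == ord0)) : \sum_f #|A f| = _)%N.
  rewrite big_distrl /= -sum_nat_const; apply: eq_bigr => g _.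
  rewrite -(card_ffun_vanishing q [set src g; tgt g]) cards2.
  have -> : src g != tgt g.
    by apply/eqP => eq_g; have := src_tgt g; rewrite eq_g ltxx.
  congr (_ * _)%N; apply: eq_card => f; rewrite !inE.
  apply/andP/forallP => [[fs ft] w|fP].
    by rewrite !inE; apply/implyP => /orP[]/eqP->.
  by move: (fP (src g)) (fP (tgt g)); rewrite !inE !eqxx orbT.
(* The exponent is 4 because, by [disj], a crossing survives only if four distinct vertices do. *)
have eX : ((\sum_f #|X f|) * q.+1 ^ 4 =
    #|[set p : G * G | cross x src tgt slope icpt p.1 p.2]| * q.+1 ^ #|V|)%N.
  rewrite (sum_card_exchange (fun (f : colouring) (p : G * G) =>
    (p \in setX (A f) (A f)) && cross x src tgt slope icpt p.1 p.2) :
    \sum_f #|X f| = _)%N.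
  rewrite (bigID (fun p : G * G => cross x src tgt slope icpt p.1 p.2)) /=.
  rewrite [X in (_ + X)%N]big1 => [|p /negbTE np]; last first.
    by apply/eqP; rewrite cards_eq0 -subset0; apply/subsetP => f; rewrite inE np andbF.
  rewrite addn0 big_distrl /= -sum_nat_const; apply: eq_big => [p|p cp].
    by rewrite inE.
  rewrite -(card_ffun_vanishing q [set v in [:: src p.1; tgt p.1; src p.2; tgt p.2]]).
  have -> : #|[set v in [:: src p.1; tgt p.1; src p.2; tgt p.2]]| = 4%N.
    by rewrite cardsE; exact: (card_uniqP (disj _ _ cp)).
  congr (_ * _)%N; apply: eq_card => f; rewrite !inE cp andbT.
  apply/andP/forallP => [[/andP[f1 f2] /andP[f3 f4]] w|fP].
    by rewrite !inE; apply/implyP => /or4P[]/eqP->.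
  by move: (fP (src p.1)) (fP (tgt p.1)) (fP (src p.2)) (fP (tgt p.2));
    rewrite !inE !eqxx ?orbT /= => -> -> -> ->.
have n_gt0 : (0 < q.+1 ^ #|V|)%N by rewrite expn_gt0.
rewrite -(leq_pmul2r n_gt0).
move: key; rewrite -(leq_pmul2r (expn_gt0 q.+1 4)).
set a := (\sum_f #|A f|)%N in eA *; set s := (\sum_f #|S f|)%N in eS *.
set c := (\sum_f #|X f|)%N in eX *.
move=> key.
have -> : (#|G| * q.+1 ^ 2 * q.+1 ^ #|V| = a * q.+1 ^ 4)%N.
  by rewrite -mulnA (mulnC (_ ^ 2)%N) mulnA -eA -mulnA -expnD.
rewrite mulnDl -eX; have -> : (3 * #|V| * q.+1 ^ 3 * q.+1 ^ #|V| = 3 * s * q.+1 ^ 4)%N.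
  rewrite -mulnA (mulnC (_ ^ 3)%N) -!mulnA; congr (_ * _)%N.
  by rewrite mulnA -eS -mulnA -expnS.
by rewrite -mulnDl.
Qed.

(** * Incidences between points and lines *)

Section SzemerediTrotter.
Variables (R : realFieldType) (V L : finType) (x y : V -> R) (m b : L -> R).

Definition incident l v := y v == m l * x v + b l.

Definition consecutive (e : L * (V * V)) :=
  [&& incident e.1 e.2.1, incident e.1 e.2.2, x e.2.1 < x e.2.2 &
    [forall w, incident e.1 w ==> ~~ (x e.2.1 < x w < x e.2.2)]].

Local Notation edge := {e | consecutive e}.
Local Notation src := (fun e : edge => (val e).2.1).
Local Notation tgt := (fun e : edge => (val e).2.2).
Local Notation line := (fun e : edge => (val e).1).
Local Notation slope := (fun e : edge => m (line e)).
Local Notation icpt := (fun e : edge => b (line e)).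

Hypothesis x_inj : injective x.
Hypothesis line_inj : forall l l', m l = m l' -> b l = b l' -> l = l'.

(** The edges of one line span the gaps between its consecutive points, so two that share [X] in
    their interiors coincide. *)
Lemma edge_same_line (g h : edge) X : line g = line h ->
  within x src tgt g X -> within x src tgt h X -> g = h.
Proof.
case: g h => [[l [u v]] gP] [[l' [u' v']] hP] /= eql.
rewrite -{l'}eql in hP *; rewrite /within /= => /andP[uX Xv] /andP[u'X Xv'].
move: gP (gP) hP (hP) => /and4P[/= lu lv uv /forallP gap] gP.
move=> /and4P[/= lu' lv' uv' /forallP gap'] hP.
have eqE : (l, (u, v)) = (l, (u', v')).
  move: (gap u') (gap v') (gap' u) (gap' v); rewrite lu lv lu' lv' /= => g1 g2 g3 g4.
  by congr (_, (_, _)); apply/x_inj/le_anti; lra.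
by apply: val_inj.
Qed.

Lemma line_inter l l' X X' : l <> l' -> m l * X + b l = m l' * X + b l' ->
  m l * X' + b l = m l' * X' + b l' -> X = X'.
Proof.
move=> neq eX eX'; apply: contrapT => neqX; apply: neq.
have eqm : m l = m l'.
  have : (m l - m l') * (X - X') = 0 by lra.
  move/eqP; rewrite mulf_eq0 !subr_eq0 => /orP[] /eqP //.
by apply: line_inj => //; rewrite eqm in eX; lra.
Qed.

Lemma cross_lines (g h : edge) : cross x src tgt slope icpt g h ->
  line g <> line h.
Proof.
move=> /asboolP[neq [X [gX hX _]]] eql; apply: neq; exact: edge_same_line eql gX hX.
Qed.

(** The two lines determine the abscissa of the crossing, and each line has only one edge over
    it. *)
Lemma card_crossings :
  (#|[set p : edge * edge | cross x src tgt slope icpt p.1 p.2]| <= #|L| ^ 2)%N.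
Proof.
rewrite -mulnn -card_prod -cardsT.
apply: (leq_card_rel (rel := fun p c => c = (line p.1, line p.2))) => [p _|].
  by exists (line p.1, line p.2).
move=> [g h] [g' h'] c; rewrite !inE /= => cgh cgh' -> [eqg eqh].
have neql := cross_lines cgh.
move: cgh cgh' => /asboolP[_ [X [gX hX eqX]]] /asboolP[_ [X' [gX' hX' eqX']]].
have eqXX' : X = X'.
  by apply: (line_inter neql eqX); rewrite eqg eqh.
rewrite -eqXX' in gX' hX'.
by rewrite (edge_same_line eqg gX gX') (edge_same_line eqh hX hX').
Qed.

(** A common end would lie on both lines, hence over their only meeting abscissa, which is interior
    to both edges. *)
Lemma cross_disjoint (g h : edge) : cross x src tgt slope icpt g h ->
  uniq [:: src g; tgt g; src h; tgt h].
Proof.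
move=> cgh; have neql := cross_lines cgh.
move: cgh => /asboolP[_ [X [/andP[gX Xg] /andP[hX Xh] eqX]]].
have [/eqP sg /eqP tg _ _] := and4P (valP g).
have [/eqP sh /eqP th _ _] := and4P (valP h).
have common v : y v = m (line g) * x v + b (line g) ->
    y v = m (line h) * x v + b (line h) -> x v = X.
  by move=> e1 e2; apply: (line_inter neql) => //; rewrite -e1.
rewrite /= !inE !negb_or andbT; apply/and3P; split; [apply/and3P; split|apply/andP; split|];
  apply/eqP => eqv.
- by move: (lt_trans gX Xg); rewrite eqv ltxx.
- by move: gX; rewrite (common _ sg) ?ltxx // eqv.
- by move: (lt_trans gX Xh); rewrite eqv ltxx.
- by move: (lt_trans hX Xg); rewrite eqv ltxx.
- by move: Xg; rewrite (common _ tg) ?ltxx // eqv.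
- by move: (lt_trans hX Xh); rewrite eqv ltxx.
Qed.

(** An incidence is charged to the edge going right from its point; the last one on a line is
    charged to the line. *)
Lemma card_incidences_edges :
  (#|[set p : L * V | incident p.1 p.2]| <= #|{: edge}| + #|L|)%N.
Proof.
pose next (p : L * V) := [exists v, incident p.1 v && (x p.2 < x v)].
rewrite -(cardsID [set p | next p]) leq_add //.
  rewrite -cardsT; apply: (leq_card_rel
    (rel := fun p (e : edge) => p = (line e, src e))) => [[l u]|p p' e _ _ -> //].
  rewrite !inE /= => /andP[lu /existsP[v0 Pv0]].
  case: (arg_minP (P := fun v => incident l v && (x u < x v)) x Pv0) => v /andP[lv uv] vmin.
  have eP : consecutive (l, (u, v)).
    rewrite /consecutive /= lu lv uv; apply/forallP => w; apply/implyP => lw.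
    apply/negP => /andP[uw]; rewrite ltNge => /negP; apply.
    by apply: vmin; rewrite lw uw.
  by exists (Sub (l, (u, v)) eP); rewrite ?inE.
rewrite -cardsT; apply: (leq_card_rel (rel := fun p l => p.1 = l)) => [p _|].
  by exists p.1; rewrite ?inE.
move=> [l u] [l' u'] c; rewrite !inE /= => /andP[nlu lu] /andP[nlu' lu'] eql eql'.
rewrite -{c}eql' in eql; rewrite -{l'}eql in nlu' lu' *; congr (_, _).
case: (ltgtP (x u) (x u')) => [ltu|ltu|/x_inj //].
  by case/existsP: nlu; exists u'; rewrite lu'.
by case/existsP: nlu'; exists u; rewrite lu.
Qed.

(** Taking [q ^ 3] of order [#|L| ^ 2 / #|V|] balances the last two terms. *)
Lemma szemeredi_trotter_sampled (q : nat) :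
  (#|[set p : L * V | incident p.1 p.2]| * q ^ 2 <=
    #|L| * q ^ 2 + 3 * #|V| * q ^ 3 + #|L| ^ 2)%N.
Proof.
have := @sampling_crossings R V edge x y src tgt slope icpt q x_inj.
move=> /(_ _ _ _ _ cross_disjoint) sampling.
have {sampling}/sampling H : forall e : edge, x (src e) < x (tgt e).
  by move=> e; case/and4P: (valP e).
have {}H := leq_trans (H _ _ _) (leq_add (leqnn _) card_crossings).
apply: leq_trans (leq_mul card_incidences_edges (leqnn _)) _.
rewrite mulnDl addnC -addnA leq_add2l; apply: H => [e|e|e w].
- by have /and4P[/eqP ? _ _ _] := valP e.
- by have /and4P[_ /eqP ? _ _] := valP e.
have /and4P[_ _ _ /forallP/(_ w)] := valP e => gap ew yw; move: gap.
by rewrite /incident yw eqxx /= (_ : _ < _ < _).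
Qed.

End SzemerediTrotter.

(** * Angles at a point *)

Lemma row2P (R : Type) (u v : 'rV[R]_2) : u 0 0 = v 0 0 -> u 0 1 = v 0 1 -> u = v.
Proof.
move=> e0 e1; apply/rowP => i; case: i => [[|[|//]]] lti.
  by rewrite (_ : Ordinal lti = 0) //; apply: val_inj.
by rewrite (_ : Ordinal lti = 1) //; apply: val_inj.
Qed.

Section PlaneAngles.
Variable R : realType.
Implicit Types u v p q : 'rV[R]_2.

Lemma dotE u v : dot u v = u 0 0 * v 0 0 + u 0 1 * v 0 1.
Proof.
rewrite /dot big_ord_recl big_ord1.
by rewrite (_ : lift ord0 ord0 = 1) //; apply: val_inj.
Qed.

Definition wedge u v : R := u 0 0 * v 0 1 - u 0 1 * v 0 0.

Lemma lagrange_identity u v : dot u u * dot v v = dot u v ^+ 2 + wedge u v ^+ 2.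
Proof. by rewrite !dotE /wedge; ring. Qed.

Lemma dot_ge0 u : 0 <= dot u u.
Proof. by rewrite dotE -!expr2 addr_ge0 ?sqr_ge0. Qed.

Lemma dot_eq0 u : (dot u u == 0) = (u == 0).
Proof.
apply/eqP/eqP => [|->]; last by rewrite dotE !mxE; ring.
rewrite dotE => /eqP; rewrite -!expr2 paddr_eq0 ?sqr_ge0 // !sqrf_eq0.
by move=> /andP[/eqP u0 /eqP u1]; apply: row2P; rewrite !mxE.
Qed.

Lemma enormM u v : enorm u * enorm v = Num.sqrt (dot u v ^+ 2 + wedge u v ^+ 2).
Proof. by rewrite -lagrange_identity sqrtrM ?dot_ge0. Qed.

(** The cosine determines the equation only up to squaring; the two signs are the two sides of the
    line through [0] and [p]. *)
Lemma angle_dot alpha p q : p != 0 -> q != p -> angle 0 p q = alpha ->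
  sin alpha * dot p (q - p) = cos alpha * wedge p (q - p) \/
  sin alpha * dot p (q - p) = - cos alpha * wedge p (q - p).
Proof.
move=> p0 qp; rewrite /angle sub0r enormM; set z := q - p.
have -> : dot (- p) z = - dot p z by rewrite !dotE !mxE; ring.
have -> : wedge (- p) z = - wedge p z by rewrite /wedge !mxE; ring.
set d := dot p z; set w := wedge p z; rewrite !sqrrN.
have N_gt0 : 0 < d ^+ 2 + w ^+ 2.
  rewrite -lagrange_identity mulr_gt0 // lt_neqAle dot_ge0 andbT eq_sym dot_eq0 //.
  by rewrite subr_eq0.
set n := Num.sqrt _.
have n_gt0 : 0 < n by rewrite sqrtr_gt0.
have n2 : n ^+ 2 = d ^+ 2 + w ^+ 2 by rewrite sqr_sqrtr ?ltW.
move=> eqa; have cosa : cos alpha * n = - d.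
  rewrite -eqa acosK ?divfK ?gt_eqF // in_itv /= ler_pdivlMr // ler_pdivrMr //.
  by rewrite mulN1r mul1r; apply/andP; split; nra.
have := cos2Dsin2 alpha; move: cosa.
set c := cos alpha; set s := sin alpha => cosa cs.
suff /eqP : (s * d) ^+ 2 = (c * w) ^+ 2.
  by rewrite eqf_sqr mulNr => /orP[]/eqP; [left|right].
rewrite !exprMn; have -> : w ^+ 2 = n ^+ 2 - d ^+ 2 by lra.
have -> : s ^+ 2 = 1 - c ^+ 2 by lra.
have -> : d ^+ 2 = c ^+ 2 * n ^+ 2 by rewrite -exprMn cosa sqrrN.
by ring.
Qed.

(** Here [- w / sin alpha] is positive with square [d ^+ 2 + w ^+ 2], so it is the product of the
    norms. *)
Lemma dot_angle alpha p q : 0 < alpha < pi -> wedge p (q - p) < 0 ->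
  sin alpha * dot p (q - p) = cos alpha * wedge p (q - p) ->
  angle 0 p q = alpha.
Proof.
move=> alphaP w_lt0 eqd.
have s_gt0 := sin_gt0_pi alphaP.
rewrite /angle sub0r enormM; set z := q - p in w_lt0 eqd *.
have -> : dot (- p) z = - dot p z by rewrite !dotE !mxE; ring.
have -> : wedge (- p) z = - wedge p z by rewrite /wedge !mxE; ring.
move: w_lt0 eqd (cos2Dsin2 alpha); set w := wedge p z; set d := dot p z.
rewrite !sqrrN => w_lt0 eqd cs.
have -> : d ^+ 2 + w ^+ 2 = (- w / sin alpha) ^+ 2.
  have -> : d = cos alpha * w / sin alpha by rewrite -eqd mulrC mulKf ?gt_eqF.
  apply: (mulIf (x := sin alpha ^+ 2)); first by rewrite expf_neq0 ?gt_eqF.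
  rewrite mulrDl !exprMn exprVn sqrrN !divfK ?expf_neq0 ?gt_eqF //.
  by rewrite -[RHS]mulr1 -cs; ring.
rewrite sqrtr_sqr ger0_norm; last by rewrite divr_ge0 ?ltW // oppr_gt0.
have -> : - d / (- w / sin alpha) = cos alpha.
  have -> : d = cos alpha * w / sin alpha by rewrite -eqd mulrC mulKf ?gt_eqF.
  by field; rewrite gt_eqF //= lt_eqF.
by rewrite cosK // in_itv /=; case/andP: alphaP => /ltW -> /ltW ->.
Qed.

End PlaneAngles.

(** * The upper bound *)

Lemma exists_notin (R : realDomainType) (s : seq R) : exists t, t \notin s.
Proof.
pose t := \sum_(z <- s) `|z| + 1.
exists t; apply/negP => st.
suff : t <= \sum_(z <- s) `|z| by rewrite /t; lra.
rewrite (big_rem t st) /= (le_trans (ler_norm t)) // lerDl sumr_ge0 //.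
Qed.

Lemma card_fset_le_rel (K : choiceType) (F : {fset K}) (U : finType)
    (B : {set U}) (rel : K -> U -> Prop) :
  (forall a, a \in F -> exists2 c, c \in B & rel a c) ->
  (forall a a' c, a \in F -> a' \in F -> rel a c -> rel a' c -> a = a') ->
  (#|` F| <= #|B|)%N.
Proof.
move=> total inj; rewrite cardfE -cardsT.
apply: (leq_card_rel (rel := fun (a : F) => rel (val a))) => [a _|a a' c _ _ ac ac'].
  exact: total (valP a).
by apply/val_inj/(inj _ _ c) => //; apply: valP.
Qed.

Section UpperBound.
Variable R : realType.
Implicit Types (s c : R) (p q : 'rV[R]_2).

(* With [s = sin alpha] and [c = cos alpha] or [- cos alpha], the vector
   [(normal0, normal1)] is normal to the line through [p] that makes the angle
   [alpha], to one side or the other, with the direction of the origin. *)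
Definition normal0 s c p := s * p 0 0 + c * p 0 1.
Definition normal1 s c p := s * p 0 1 - c * p 0 0.

(** The right-hand side makes the line pass through the apex [e.1]. *)
Definition on_ray_line s c (e : 'rV[R]_2 * 'rV[R]_2) :=
  normal0 s c e.1 * e.2 0 0 + normal1 s c e.1 * e.2 0 1 == s * dot e.1 e.1.

Lemma on_ray_lineE s c p q :
  on_ray_line s c (p, q) = (s * dot p (q - p) == c * wedge p (q - p)).
Proof.
rewrite /on_ray_line /normal0 /normal1 !dotE /wedge !mxE -[RHS]subr_eq0 -[LHS]subr_eq0 /=.
by congr (_ == 0); ring.
Qed.

Lemma card_on_ray_line s c (E : {fset 'rV[R]_2}) (F : {fset 'rV[R]_2 * 'rV[R]_2}) k :
  0 < s -> s ^+ 2 + c ^+ 2 = 1 ->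
  (forall e, e \in F -> [/\ e.1 \in E, e.2 \in E, e.1 != 0 & on_ray_line s c e]) ->
  (#|` F| * k ^ 2 <= #|` E| * k ^ 2 + 3 * #|` E| * k ^ 3 + #|` E| ^ 2)%N.
Proof.
move=> s_gt0 sc FP; pose L := [fset p in E | p != 0]%fset.
have L_neq0 (l : L) : val l != 0 by move: (valP l); rewrite !inE => /andP[].
have LE : (#|{: L}| <= #|` E|)%N.
  by rewrite -cardfE; apply: fsubset_leq_card; apply: fset_sub.
(* The shear [X + t Y] separates the first coordinates of the points of [E] and
   makes none of the lines vertical. *)
have [t] := exists_notin
  ([seq normal1 s c p / normal0 s c p | p <- E] ++
   [seq (v 0 0 - w 0 0) / (w 0 1 - v 0 1) | v : 'rV[R]_2 <- E, w : 'rV[R]_2 <- E]).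
rewrite mem_cat negb_or => /andP[tN tE].
pose x (v : E) := val v 0 0 + t * val v 0 1.
pose y (v : E) := val v 0 1.
(* In the sheared coordinates the line of [l] is [N0 l * x + N1 l * y = K l]. *)
pose N0 (l : L) := normal0 s c (val l).
pose N1 (l : L) := normal1 s c (val l) - t * N0 l.
pose K (l : L) := s * dot (val l) (val l).
have dot_gt0 (l : L) : 0 < dot (val l) (val l).
  by rewrite lt_neqAle eq_sym dot_eq0 L_neq0 dot_ge0.
have normalN p : normal0 s c p ^+ 2 + normal1 s c p ^+ 2 = dot p p.
  by rewrite -[RHS]mul1r -sc /normal0 /normal1 dotE; ring.
have N1_neq0 l : N1 l != 0.
  rewrite /N1; have [N0l|N0l] := eqVneq (N0 l) 0.
    apply/eqP => N1l; move: (dot_gt0 l); rewrite -normalN -/(N0 l) N0l.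
    by have -> : normal1 s c (val l) = 0 by [rewrite -N1l N0l; ring]; lra.
  apply: contra tN; rewrite subr_eq0 => /eqP N1l; apply/mapP.
  exists (val l); last by rewrite N1l mulfK.
  by move: (valP l); rewrite !inE => /andP[].
have K_neq0 l : K l != 0 by rewrite /K mulf_neq0 ?gt_eqF.
have x_inj : injective x.
  move=> v w; rewrite /x => eqx; apply/val_inj.
  have [eqy|neqy] := eqVneq (val w 0 1) (val v 0 1).
    by apply: row2P => //; move: eqx; rewrite eqy; apply: addIr.
  case/negP: tE; apply/allpairsP; exists (val v, val w); split; try exact: valP.
  rewrite /=; apply: (mulIf (x := val w 0 1 - val v 0 1)); first by rewrite subr_eq0.
  by rewrite divfK ?subr_eq0 //; move: eqx; lra.
have line_inj (l l' : L) : - N0 l / N1 l = - N0 l' / N1 l' ->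
    K l / N1 l = K l' / N1 l' -> l = l'.
  (* Equal lines have proportional equations, with ratio [r]. *)
  move=> eqm eqb; apply/val_inj.
  pose r := N1 l' / N1 l.
  have n1' : N1 l' = r * N1 l by rewrite divfK.
  have n0' : N0 l' = r * N0 l.
    have -> : N0 l' = - (- N0 l' / N1 l') * N1 l' by field.
    by rewrite -eqm /r; field.
  have k' : K l' = r * K l.
    have -> : K l' = (K l' / N1 l') * N1 l' by field.
    by rewrite -eqb /r; field.
  have m1 l0 : normal1 s c (val l0) = N1 l0 + t * N0 l0 by rewrite /N1; ring.
  have m1' : normal1 s c (val l') = r * normal1 s c (val l).
    by rewrite !m1 n1' n0'; ring.
  (* [K] is [s] times the squared length of the normal, so it scales by [r ^+ 2] as well as by
     [r]. *)
  have r1 : r = 1.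
    have r_neq0 : r != 0 by rewrite mulf_neq0 ?invr_eq0.
    apply: (mulIf (K_neq0 l)); apply: (mulfI r_neq0).
    have k2 : K l' = r ^+ 2 * K l.
      by rewrite /K -!normalN m1' -/(N0 l') n0' /N0; ring.
    by rewrite mul1r mulrA -expr2 -k2 k'.
  rewrite r1 !mul1r /N0 in m1' n0'.
  (* The normal is a rotation of [p], inverted here. *)
  have e0 p : p 0 0 = s * normal0 s c p - c * normal1 s c p.
    by rewrite -[LHS]mul1r -sc /normal0 /normal1; ring.
  have e1 p : p 0 1 = c * normal0 s c p + s * normal1 s c p.
    by rewrite -[LHS]mul1r -sc /normal0 /normal1; ring.
  by apply: row2P; [rewrite !e0 m1' n0' | rewrite !e1 m1' n0'].
have := @szemeredi_trotter_sampled R E L x y (fun l => - N0 l / N1 l)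
  (fun l => K l / N1 l) x_inj line_inj k.
set J := [set p | _] => H.
have FJ : (#|` F| <= #|J|)%N.
  apply: (card_fset_le_rel (rel := fun e j => e = (val j.1, val j.2)));
    last by move=> e e' j _ _ ->.
  move=> [p q] /FP[/= Ep Eq p0 pq].
  have Lp : p \in L by rewrite !inE Ep.
  exists ([` Lp]%fset, [` Eq]%fset) => //; rewrite inE /incident /=.
  set l := [` Lp]%fset; set v := [` Eq]%fset.
  have -> : K l = N0 l * x v + N1 l * y v.
    by rewrite /K -(eqP pq) /N1 /N0 /x /y /=; ring.
  by apply/eqP; field.
have EE : #|{: E}| = #|` E| by rewrite cardfE.
rewrite EE in H.
apply: leq_trans (leq_mul FJ (leqnn _)) (leq_trans H _).
by rewrite leq_add ?leq_add ?leq_mul ?leq_exp2r.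
Qed.

End UpperBound.

(** The two signs in [angle_dot] give two families of lines, hence the factor 2. *)
Lemma card_angle_pairs (R : realType) (alpha : R) (E : {fset 'rV[R]_2}) k :
  0 < alpha < pi ->
  (#|` angle_pairs alpha E| * k ^ 2 <=
    2 * (#|` E| * k ^ 2 + 3 * #|` E| * k ^ 3 + #|` E| ^ 2))%N.
Proof.
move=> /sin_gt0_pi s_gt0; have cs := cos2Dsin2 alpha.
pose s := sin alpha; pose c := cos alpha.
pose F d := [fset e in angle_pairs alpha E | on_ray_line s d e]%fset.
have FP d e : e \in F d ->
    [/\ e.1 \in E, e.2 \in E, e.1 != 0 & on_ray_line s d e].
  rewrite !inE => /andP[/andP[/andP[-> ->] /and3P[e0 _ _]] ->].
  by rewrite eq_sym.
have Fp := card_on_ray_line (s := s) (c := c) k s_gt0 _ (@FP c).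
have Fm := card_on_ray_line (s := s) (c := - c) k s_gt0 _ (@FP (- c)).
have sub : (angle_pairs alpha E `<=` F c `|` F (- c))%fset.
  apply/fsubsetP => -[p q]; rewrite !inE /= => /andP[-> /and3P[p0 pq /eqP eqa]].
  rewrite p0 pq eqa eqxx /= !on_ray_lineE; rewrite eq_sym in p0; rewrite eq_sym in pq.
  by case: (angle_dot p0 pq eqa) => /eqP ->; rewrite ?orbT.
have := fsubset_leq_card sub; have := cardfsU (F c) (F (- c)).
have {}Fp := Fp _; have {}Fm := Fm _.
have {Fp}/Fp : s ^+ 2 + c ^+ 2 = 1 by rewrite addrC.
have {Fm}/Fm : s ^+ 2 + (- c) ^+ 2 = 1 by rewrite sqrrN addrC.
move: (#|` F c|)%N (#|` F (- c)|)%N (#|` (_ `|` _)%fset|)%N (#|` (_ `&` _)%fset|)%N.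
set n := #|` E|; set a := #|` angle_pairs _ _|.
move=> f1 f2 u i H1 H2 Hu Ha.
have : (a <= f1 + f2)%N by lia.
by move=> /(leq_mul (leqnn (k ^ 2))); lia.
Qed.

Lemma cube_root_bounds n : exists k, (k ^ 3 <= n < k.+1 ^ 3)%N.
Proof.
elim: n => [|n [k /andP[kn nk]]]; first by exists 0%N.
case: (ltnP n.+1 (k.+1 ^ 3)) => H; first by exists k; rewrite H andbT ltnW.
exists k.+1; rewrite H /= (leq_ltn_trans nk) //.
by rewrite ltn_exp2r.
Qed.

Lemma powR43 (R : realType) (n : nat) : (0 < n)%N ->
  exists r : R, [/\ 0 <= r, r ^+ 3 = n%:R & n%:R `^ (4 / 3) = n%:R * r].
Proof.
move=> n_gt0; exists (n%:R `^ (3^-1)); split; first exact: powR_ge0.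
  by rewrite -powR_mulrn ?powR_ge0 // -powRrM mulVf ?powRr1 // pnatr_eq0.
rewrite (_ : 4 / 3 = 1 + 3^-1); last by field.
by rewrite powRD ?powRr1 // pnatr_eq0 -lt0n n_gt0 implybT.
Qed.

Lemma angle_pairs_upper (R : realType) (alpha : R) (E : {fset 'rV[R]_2}) :
  0 < alpha < pi -> (0 < #|` E|)%N ->
  #|` angle_pairs alpha E|%:R <= 20 * #|` E|%:R `^ (4 / 3) :> R.
Proof.
move=> alphaP; set n := #|` E| => n_gt0.
have [r [r_ge0 r3 ->]] := powR43 R n_gt0.
have [k /andP[kn nk]] := cube_root_bounds n.
have := card_angle_pairs E k.+1 alphaP; rewrite -/n; set a := #|` _| => H.
have k_gt0 : (0 < k)%N by rewrite lt0n; apply/eqP => k0; rewrite k0 in nk; lia.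
(* For [q = k.+1], both [n * q ^ 2] and [n ^ 2] are at most [n * q ^ 3], so the bound is
   [2 * 5 * (n * q ^ 3)]. *)
have Hk : (a <= 10 * (n * k.+1))%N.
  have k2 : (0 < k.+1 ^ 2)%N by rewrite expn_gt0.
  rewrite -(leq_pmul2r k2) (leq_trans H) //.
  have -> : (10 * (n * k.+1) * k.+1 ^ 2 = 10 * (n * k.+1 ^ 3))%N.
    by rewrite -!mulnA -expnS.
  have n1 : (n * n <= n * k.+1 ^ 3)%N by rewrite leq_mul2l ltnW ?orbT.
  have n2 : (n * k.+1 ^ 2 <= n * k.+1 ^ 3)%N by rewrite leq_mul2l leq_exp2l ?orbT.
  by rewrite -mulnn; lia.
(* Since [k] is positive, [k.+1 <= 2 * k]; this turns 10 into 20. *)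
have kr : k.+1%:R <= 2 * r.
  have kr3 : k%:R <= r by rewrite -(@ler_pXn2r _ 3) ?nnegrE // r3 -natrX ler_nat.
  by have : k.+1%:R <= 2 * k%:R :> R; [rewrite -natrM ler_nat; lia | lra].
have : a%:R <= 10 * (n%:R * k.+1%:R) :> R by rewrite -!natrM ler_nat.
have : n%:R * k.+1%:R <= n%:R * (2 * r) by rewrite ler_wpM2l.
lra.
Qed.

(** * The extremal configuration *)

Section LowerBound.
Variables (R : realType) (alpha : R).

Definition point (a b : R) : 'rV[R]_2 := \row_(i < 2) if i == 0 then a else b.

Lemma point0 a b : point a b 0 0 = a. Proof. by rewrite mxE. Qed.
Lemma point1 a b : point a b 0 1 = b. Proof. by rewrite mxE. Qed.

Lemma point_inj a b a' b' : point a b = point a' b' -> a = a' /\ b = b'.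
Proof.
move=> eqp; split; first by rewrite -(point0 a b) eqp point0.
by rewrite -(point1 a b) eqp point1.
Qed.

Let cot := cos alpha / sin alpha.

(* The point of the line [Y = M X + b] at which the half line to the right makes
   the angle [alpha] with the direction of the origin. *)
Definition apex_x (M b : R) := - (b * (M + cot) / (1 + M ^+ 2)).
Definition apex M b := point (apex_x M b) (M * apex_x M b + b).

Lemma apex_xE M b : apex_x M b * (1 + M ^+ 2) = - (b * (M + cot)).
Proof.
rewrite /apex_x mulNr divfK // gt_eqF // -[ltLHS]addr0 ltr_leD ?sqr_ge0 //.
Qed.

(** For an apex [(u, v)], substituting [b = v - M * u] makes [apex_xE] linear in [M] with
    coefficient [v - cot * u]. If that vanishes, the apex is the origin and [b = 0]. *)
Lemma apex_inj M b M' b' : b != 0 -> apex M b = apex M' b' -> M = M' /\ b = b'.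
Proof.
move=> b0 /point_inj[]; have := apex_xE M b; have := apex_xE M' b'.
move: (apex_x M b) (apex_x M' b') => u u' e' e equ; rewrite -{u'}equ in e' * => e2.
have eqM : M = M'.
  have : (M - M') * (M * u + b - cot * u) = 0 by nra.
  move/eqP; rewrite mulf_eq0 !subr_eq0 => /orP[/eqP //|/eqP eqc].
  case/eqP: b0.
  have u0 : u * (1 + cot ^+ 2) = 0 by nra.
  have {}u0 : u = 0.
    apply/eqP; move/eqP: u0; rewrite mulf_eq0 => /orP[//|].
    by rewrite gt_eqF // -[ltLHS]addr0 ltr_leD ?sqr_ge0.
  by rewrite u0 in eqc; lra.
by split=> //; rewrite eqM in e2; lra.
Qed.

(** The sign conditions put the apex at abscissa at most 0, left of [q], which gives the wedge the
    sign that [dot_angle] requires. *)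
Lemma apex_angle M b X : 0 < alpha < pi -> 0 < b -> 0 <= M + cot -> 0 < X ->
  let p := apex M b in let q := point X (M * X + b) in
  [&& 0 != p, p != q & angle 0 p q == alpha].
Proof.
move=> alphaP b_gt0 Mc X_gt0 /=; set p := apex M b; set q := point _ _.
have s_gt0 := sin_gt0_pi alphaP.
have u_le0 : apex_x M b <= 0.
  rewrite /apex_x oppr_le0 divr_ge0 ?addr_ge0 ?sqr_ge0 //.
  by rewrite mulr_ge0 // ltW.
have ucE := apex_xE M b.
have p0 : p 0 0 = apex_x M b by rewrite point0.
have p1 : p 0 1 = M * apex_x M b + b by rewrite point1.
have q0 : (q - p) 0 0 = X - apex_x M b by rewrite mxE [X in _ + X]mxE p0 point0.
have q1 : (q - p) 0 1 = M * (X - apex_x M b).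
  by rewrite mxE [X in _ + X]mxE p1 point1; ring.
have w : wedge p (q - p) = - (b * (X - apex_x M b)).
  by rewrite /wedge p0 p1 q0 q1; ring.
have w_lt0 : wedge p (q - p) < 0 by rewrite w oppr_lt0 mulr_gt0 //; lra.
have pz : p != 0.
  by apply: contraTneq w_lt0 => ->; rewrite /wedge !mxE !mul0r subrr ltxx.
have pq : p != q.
  by apply: contraTneq w_lt0 => ->; rewrite /wedge subrr !mxE !mulr0 subrr ltxx.
rewrite eq_sym pz pq /=; apply/eqP/dot_angle => //.
rewrite w dotE p0 p1 q0 q1.
have -> : cos alpha = sin alpha * cot by rewrite /cot mulrC divfK ?gt_eqF.
have : apex_x M b + M * (M * apex_x M b + b) = - (b * cot) by lra.
move: (apex_x M b) => u e.
transitivity (sin alpha * ((X - u) * (u + M * (M * u + b)))); first by ring.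
by rewrite e; ring.
Qed.

Variable k : nat.
(** The grid below is sheared by the same [|cot|], which preserves incidences. Indices start at 1
    because [apex_angle] needs positive abscissas and intercepts. *)
Let slope (i : 'I_k) : R := i.+1%:R + `|cot|.
Let grid (t : 'I_k * 'I_(2 * k ^ 2)) :=
  point t.1.+1%:R (`|cot| * t.1.+1%:R + t.2.+1%:R).
Let apexes (t : 'I_k * 'I_(k ^ 2)) := apex (slope t.1) t.2.+1%:R.
Let config_point (t : ('I_k * 'I_(2 * k ^ 2)) + ('I_k * 'I_(k ^ 2))) :=
  match t with inl g => grid g | inr a => apexes a end.

Definition config : {fset 'rV[R]_2} := [fset config_point t | t in predT]%fset.

(** Coincidences among grid points and apexes can only lower the count. *)
Lemma config_card_le : (#|` config| <= 3 * k ^ 3)%N.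
Proof.
have -> : (3 * k ^ 3 = #|[set: ('I_k * 'I_(2 * k ^ 2)) + ('I_k * 'I_(k ^ 2))]|)%N.
  by rewrite cardsT card_sum !card_prod !card_ord !expnS; lia.
apply: (card_fset_le_rel (rel := fun e t => e = config_point t)) => [e|e e' t _ _ -> //].
by move=> /imfsetP[t _ ->]; exists t.
Qed.

Lemma config_card_ge : (2 * k ^ 3 <= #|` config|)%N.
Proof.
have -> : (2 * k ^ 3 = #|[set: 'I_k * 'I_(2 * k ^ 2)]|)%N.
  by rewrite cardsT card_prod !card_ord !expnS; lia.
rewrite cardfE -cardsT.
apply: (leq_card_rel (rel := fun t (e : config) => val e = grid t)) => [t _|].
  have tP : grid t \in config by apply/imfsetP; exists (inl t).
  by exists [` tP]%fset.
move=> [i j] [i' j'] e _ _ -> /point_inj[/= /eqP]; rewrite eqr_nat eqSS => /eqP/val_inj ->.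
by move=> /addrI/eqP; rewrite eqr_nat eqSS => /eqP/val_inj ->.
Qed.

(** Each of the [k ^ 3] lines meets all [k] columns in grid points; the apex determines the line,
    and the abscissa the column. *)
Lemma config_angle_pairs : 0 < alpha < pi ->
  (k ^ 4 <= #|` angle_pairs alpha config|)%N.
Proof.
move=> alphaP; have -> : (k ^ 4 = #|[set: ('I_k * 'I_(k ^ 2)) * 'I_k]|)%N.
  by rewrite cardsT !card_prod !card_ord !expnS; lia.
rewrite cardfE -cardsT.
apply: (leq_card_rel (rel := fun (t : ('I_k * 'I_(k ^ 2)) * 'I_k)
  (e : angle_pairs alpha config) => val e =
  (apexes t.1, point t.2.+1%:R (slope t.1.1 * t.2.+1%:R + t.1.2.+1%:R)))) => [[[i b] j] _|].
  pose e := (apexes (i, b), point j.+1%:R (slope i * j.+1%:R + b.+1%:R)).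
  have eP : e \in angle_pairs alpha config.
    rewrite !inE /=; apply/andP; split; last first.
      apply: apex_angle => //; rewrite /slope -addrA addr_ge0 //.
      by have := ler_norm (- cot); rewrite normrN; lra.
    apply/andP; split; apply/imfsetP; first by exists (inr (i, b)).
    (* The row index is one less than the unsheared height; its two summands are bounded by [k ^ 2]
       each, whence [2 * k ^ 2] rows. *)
    have jP : (i.+1 * j.+1 + b < 2 * k ^ 2)%N.
      have := leq_mul (ltn_ord i) (ltn_ord j); have := ltn_ord b.
      by rewrite !mulnn; lia.
    exists (inl (j, Ordinal jP)) => //=; congr point.
    rewrite /slope /= -[in RHS]addnS natrD natrM; ring.
  by exists [` eP]%fset.
move=> [[i b] j] [[i' b'] j'] e _ _ -> /= [/apex_inj[]].
  by rewrite pnatr_eq0.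
move=> /addIr/eqP; rewrite eqr_nat eqSS => /eqP/val_inj /= ->.
move=> /eqP; rewrite eqr_nat eqSS => /eqP/val_inj /= ->.
by move=> /point_inj[/eqP]; rewrite eqr_nat eqSS => /eqP/val_inj ->.
Qed.

End LowerBound.

Local Open Scope fset_scope.

Theorem theorem2p6 (R : realType) (alpha : R) (halpha : 0 < alpha < pi) :
  (exists (C : R) (N : nat), 0 < C /\
     forall n : nat, (N < n)%N ->
     forall E : {fset 'rV[R]_2}, #|` E| = n ->
       #|` angle_pairs alpha E|%:R <= C * n%:R `^ (4 / 3)) /\
  (exists (C1 C2 C3 : R) (N : nat), [/\ 0 < C1, 0 < C2, 0 < C3 &
     forall n : nat, (N < n)%N ->
     exists E : {fset 'rV[R]_2},
       [/\ #|` E|%:R <= C1 * n%:R,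
           n%:R <= C2 * #|` E|%:R :> R &
           n%:R `^ (4 / 3) <= C3 * #|` angle_pairs alpha E|%:R]]).
Proof.
split.
  exists 20, 0%N; split=> // n n_gt0 E cardE.
  by rewrite -cardE in n_gt0 *; apply: angle_pairs_upper.
(* With [k ^ 3 <= n <= 8 * k ^ 3]: the set has between [2 * k ^ 3] and [3 * k ^ 3] points, giving 4
   and 3, and [(2 * k) ^ 4 = 16 * k ^ 4] gives 16. *)
exists 3, 4, 16, 0%N; split=> // n n_gt0.
have [k /andP[kn nk]] := cube_root_bounds n.
have k_gt0 : (0 < k)%N by rewrite lt0n; apply/eqP => k0; rewrite k0 in nk; lia.
have n8 : (n <= (2 * k) ^ 3)%N.
  by rewrite (leq_trans (ltnW nk)) // leq_exp2r //; lia.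
exists (config alpha k); split.
- rewrite -natrM ler_nat (leq_trans (config_card_le _ _)) //; lia.
- rewrite -natrM ler_nat (leq_trans n8) // expnMn.
  by have := config_card_ge alpha k; lia.
have [r [r_ge0 r3 ->]] := powR43 R n_gt0.
have rk : r <= (2 * k)%:R.
  by rewrite -(@ler_pXn2r _ 3) ?nnegrE // r3 -natrX ler_nat.
have : n%:R * r <= ((2 * k) ^ 3)%:R * (2 * k)%:R.
  by apply: ler_pM => //; rewrite ler_nat.
move=> /le_trans; apply; rewrite -!natrM ler_nat -expnSr expnMn.
by rewrite leq_mul2l config_angle_pairs.
Qed.
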